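(* Define three sequences of real numbers as follows. (Brent–Salamin) Let $a_0:=1$, $b_0:=1/\sqrt{2}$, and for $n\ge 1$ let $a_n:=\frac{a_{n-1}+b_{n-1}}{2}$, $b_n:=\sqrt{a_{n-1}b_{n-1}}$, $c_n^2:=a_n^2-b_n^2$. For $N\ge 0$ put $$p_N:=\frac{(a_N+b_N)^2}{1-2\sum_{j=1}^N 2^j c_j^2}.$$ (Borwein quadratic) Let $k_0:=3-2\sqrt{2}$, $e_0:=6-4\sqrt{2}$, and for $n\ge1$ let $k_n:=\frac{1-\sqrt{1-k_{n-1}^2}}{1+\sqrt{1-k_{n-1}^2}}$, $e_n:=e_{n-1}(1+k_n)^2-2^{n+1}k_n$. For $N\ge0$ put $\widehat{\pi}_N:=1/e_N$. (Borwein quartic) Let $y_0:=\sqrt{2}-1$, $z_0:=6-4\sqrt{2}$, and for $n\ge1$ let $y_n:=\frac{1-\sqrt[4]{1-y_{n-1}^4}}{1+\sqrt[4]{1-y_{n-1}^4}}$, $z_n:=z_{n-1}(1+y_n)^4-2\cdot 4^n y_n(1+y_n+y_n^2)$. For $N\ge 0$ put $\pi_N:=1/z_N$. Then for all $N\ge 0$, $$\widehat{\pi}_N=p_N\qquad\text{and}\qquad \pi_N=\widehat{\pi}_{2N}=p_{2N}.$$ *)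

(* Defs.v *)
From mathcomp Require Import all_boot all_order all_algebra.
From mathcomp Require Import reals exp.

Set Implicit Arguments.
Unset Strict Implicit.
Unset Printing Implicit Defensive.

Import Order.TTheory GRing.Theory Num.Theory.
Local Open Scope ring_scope.

Section PiAlgorithms.
Variable R : realType.

Fixpoint brent_salamin_ab (n : nat) : R * R :=
  if n is m.+1 then
    let: (a, b) := brent_salamin_ab m in ((a + b) / 2, Num.sqrt (a * b))
  else (1, 1 / Num.sqrt 2).

Definition brent_salamin_a (n : nat) : R := (brent_salamin_ab n).1.
Definition brent_salamin_b (n : nat) : R := (brent_salamin_ab n).2.

(* This is c_n^2; the number c_n itself is never used. *)
Definition brent_salamin_csq (n : nat) : R := brent_salamin_a n ^+ 2 - brent_salamin_b n ^+ 2.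

Definition brent_salamin_p (N : nat) : R :=
  (brent_salamin_a N + brent_salamin_b N) ^+ 2 /
  (1 - 2 * \sum_(1 <= j < N.+1) 2 ^+ j * brent_salamin_csq j).

Fixpoint borwein2_k (n : nat) : R :=
  if n is m.+1 then
    let s := Num.sqrt (1 - borwein2_k m ^+ 2) in (1 - s) / (1 + s)
  else 3 - 2 * Num.sqrt 2.

Fixpoint borwein2_e (n : nat) : R :=
  if n is m.+1 then
    borwein2_e m * (1 + borwein2_k n) ^+ 2 - 2 ^+ n.+1 * borwein2_k n
  else 6 - 4 * Num.sqrt 2.

Definition borwein2_pi (N : nat) : R := 1 / borwein2_e N.

(* powR is the genuine fourth root only for nonnegative arguments; here
   0 < 1 - y_m ^+ 4 for every m. *)
Fixpoint borwein4_y (n : nat) : R :=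
  if n is m.+1 then
    let s := (1 - borwein4_y m ^+ 4) `^ (1 / 4) in (1 - s) / (1 + s)
  else Num.sqrt 2 - 1.

Fixpoint borwein4_z (n : nat) : R :=
  if n is m.+1 then
    borwein4_z m * (1 + borwein4_y n) ^+ 4
    - 2 * 4 ^+ n * borwein4_y n * (1 + borwein4_y n + borwein4_y n ^+ 2)
  else 6 - 4 * Num.sqrt 2.

Definition borwein4_pi (N : nat) : R := 1 / borwein4_z N.

End PiAlgorithms.

(* Main.v *)
(** With [a], [b] the arithmetic-geometric iterates, the quadratic Borwein
    modulus is [k n = (a n - b n) / (a n + b n)], and [e n * (a n + b n) ^+ 2] is
    the denominator of the Brent-Salamin quotient [p n].  One quartic step is two
    quadratic ones: [y n ^+ 2 = k (2 * n)] and [z n = e (2 * n)], because if [t] is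
    the fourth root of [1 - y n ^+ 4], then the next two quadratic moduli are
    [(1 - t ^+ 2) / (1 + t ^+ 2)] and [((1 - t) / (1 + t)) ^+ 2]. *)
Require Import Defs.
From mathcomp Require Import all_boot all_order all_algebra.
From mathcomp Require Import reals exp.
From mathcomp Require Import ring lra.

Import Order.TTheory GRing.Theory Num.Theory.
Local Open Scope ring_scope.

Section BrentSalaminBorwein.
Variable R : realType.

Local Notation a := (brent_salamin_a R).
Local Notation b := (brent_salamin_b R).
Local Notation k := (borwein2_k R).
Local Notation e := (borwein2_e R).
Local Notation y := (borwein4_y R).
Local Notation z := (borwein4_z R).

Lemma brent_salamin_aS n : a n.+1 = (a n + b n) / 2.
Proof.
by rewrite /brent_salamin_a /brent_salamin_b /=; case: brent_salamin_ab.
Qed.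

Lemma brent_salamin_bS n : b n.+1 = Num.sqrt (a n * b n).
Proof.
by rewrite /brent_salamin_a /brent_salamin_b /=; case: brent_salamin_ab.
Qed.

Lemma borwein2_kS n :
  k n.+1 = (1 - Num.sqrt (1 - k n ^+ 2)) / (1 + Num.sqrt (1 - k n ^+ 2)).
Proof. by []. Qed.

Lemma borwein2_eS n :
  e n.+1 = e n * (1 + k n.+1) ^+ 2 - 2 ^+ n.+2 * k n.+1.
Proof. by []. Qed.

Lemma borwein4_yS n :
  y n.+1 = (1 - (1 - y n ^+ 4) `^ (1 / 4)) / (1 + (1 - y n ^+ 4) `^ (1 / 4)).
Proof. by []. Qed.

Lemma borwein4_zS n :
  z n.+1 = z n * (1 + y n.+1) ^+ 4
    - 2 * 4 ^+ n.+1 * y n.+1 * (1 + y n.+1 + y n.+1 ^+ 2).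
Proof. by []. Qed.

Lemma brent_salamin_gt0 n : 0 < a n /\ 0 < b n.
Proof.
elim: n => [|n [a0 b0]].
  by rewrite /brent_salamin_a /brent_salamin_b /= divr_gt0 // sqrtr_gt0.
by rewrite brent_salamin_aS brent_salamin_bS sqrtr_gt0; split; nra.
Qed.

Lemma sqr_brent_salamin_bS n : b n.+1 ^+ 2 = a n * b n.
Proof.
have [a0 b0] := brent_salamin_gt0 n.
by rewrite brent_salamin_bS sqr_sqrtr // mulr_ge0 // ltW.
Qed.

(** By induction, [1 - k n ^+ 2] is [4 * a n * b n / (a n + b n) ^+ 2], the square of
    [b n.+1 / a n.+1], so the root in the recurrence disappears. *)
Lemma borwein2_kE n : k n = (a n - b n) / (a n + b n).
Proof.
elim: n => [|n IHn].
  rewrite /brent_salamin_a /brent_salamin_b /=.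
  have r2 : Num.sqrt 2 ^+ 2 = 2 :> R by rewrite sqr_sqrtr.
  have : 0 < Num.sqrt 2 :> R by rewrite sqrtr_gt0.
  move: (Num.sqrt 2 : R) r2 => r r2 r0.
  have -> : 1 / r = r / 2 by rewrite -[in r / 2]r2; field; lra.
  apply: (canRL (mulfK _)); first by lra.
  (* The expansion keeps [r ^+ 2] visible so that [r2] can replace it by 2. *)
  by rewrite [LHS](_ : _ = 3 - r / 2 - r ^+ 2); [rewrite r2; lra | field].
have [a0 b0] := brent_salamin_gt0 n.
have [a1 b1] := brent_salamin_gt0 n.+1.
have -> : k n.+1 = (1 - b n.+1 / a n.+1) / (1 + b n.+1 / a n.+1).
  rewrite borwein2_kS; suff -> : 1 - k n ^+ 2 = (b n.+1 / a n.+1) ^+ 2.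
    by rewrite sqrtr_sqr ger0_norm // ltW // divr_gt0.
  by rewrite expr_div_n sqr_brent_salamin_bS brent_salamin_aS IHn; field; lra.
by field; apply/andP; split; lra.
Qed.

Lemma borwein2_k_lt1 n : 0 < 1 - k n ^+ 2.
Proof.
have [a0 b0] := brent_salamin_gt0 n.
have -> : 1 - k n ^+ 2 = 4 * a n * b n / (a n + b n) ^+ 2.
  by rewrite borwein2_kE; field; lra.
by rewrite divr_gt0 ?exprn_gt0 ?addr_gt0 ?mulr_gt0.
Qed.

(** Multiplying the recurrence for [e n.+1] by [(a n.+1 + b n.+1) ^+ 2] turns [(1 + k n.+1) ^+ 2]
    into [(2 * a n.+1) ^+ 2 = (a n + b n) ^+ 2] and [k n.+1] into [a n.+1 ^+ 2 - b n.+1 ^+ 2], so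
    the sum gains exactly one term. *)
Lemma borwein2_eM n :
  e n * (a n + b n) ^+ 2 =
  1 - 2 * \sum_(1 <= j < n.+1) 2 ^+ j * brent_salamin_csq R j.
Proof.
elim: n => [|n IHn].
  rewrite big_geq // /brent_salamin_a /brent_salamin_b /=.
  have r2 : Num.sqrt 2 ^+ 2 = 2 :> R by rewrite sqr_sqrtr.
  have : 0 < Num.sqrt 2 :> R by rewrite sqrtr_gt0.
  move: (Num.sqrt 2 : R) r2 => r r2 r0.
  have -> : 1 / r = r / 2 by rewrite -[in r / 2]r2; field; lra.
  rewrite [LHS](_ : _ = 6 + 2 * r - r ^+ 2 * (5 / 2) - r ^+ 2 * r); last by field.
  by rewrite r2; lra.
have [a1 b1] := brent_salamin_gt0 n.+1.
rewrite big_nat_recr //= mulrDr opprD addrA -IHn -/(k n.+1) borwein2_kE.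
have -> : a n + b n = 2 * a n.+1 by rewrite brent_salamin_aS; field.
by rewrite /brent_salamin_csq [2 ^+ n.+2]exprS; field; lra.
Qed.

Lemma powR_quarter (x : R) : 0 <= x -> x `^ (1 / 4) = Num.sqrt (Num.sqrt x).
Proof.
move=> x0; have -> : 1 / 4 = 2^-1 * 2^-1 :> R by field.
by rewrite powRrM !powR12_sqrt ?sqrtr_ge0.
Qed.

(** Both radicands are perfect squares: the first is [(t ^+ 2) ^+ 2], the second
    [(2 * t / (1 + t ^+ 2)) ^+ 2]. *)
Lemma borwein2_two_steps n (t : R) : 0 <= t -> 1 - k n ^+ 2 = t ^+ 4 ->
  k n.+1 = (1 - t ^+ 2) / (1 + t ^+ 2) /\ k n.+2 = ((1 - t) / (1 + t)) ^+ 2.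
Proof.
move=> t0 kt.
have k1 : k n.+1 = (1 - t ^+ 2) / (1 + t ^+ 2).
  rewrite borwein2_kS kt (_ : t ^+ 4 = (t ^+ 2) ^+ 2); last by rewrite -exprM.
  by rewrite sqrtr_sqr ger0_norm // sqr_ge0.
split=> //; have t2 := sqr_ge0 t.
have -> : k n.+2 = (1 - 2 * t / (1 + t ^+ 2)) / (1 + 2 * t / (1 + t ^+ 2)).
  rewrite borwein2_kS; suff -> : 1 - k n.+1 ^+ 2 = (2 * t / (1 + t ^+ 2)) ^+ 2.
    by rewrite sqrtr_sqr ger0_norm // divr_ge0 //; lra.
  by rewrite k1; field; lra.
by field; rewrite !lt0r_neq0 //; nra.
Qed.

(** One joint induction, since the step for [z] needs [y n ^+ 4 = k (2 * n) ^+ 2] to express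
    [y n.+1] through [t]. *)
Lemma borwein4_yzE n : y n ^+ 2 = k (2 * n)%N /\ z n = e (2 * n)%N.
Proof.
elim: n => [|n [yk ze]].
  split=> //=; have r2 : Num.sqrt 2 ^+ 2 = 2 :> R by rewrite sqr_sqrtr.
  by rewrite sqrrB r2; ring.
rewrite mulnS !add2n.
have k0 := borwein2_k_lt1 (2 * n).
have y4 : y n ^+ 4 = k (2 * n)%N ^+ 2 by rewrite -yk -exprM.
pose t := Num.sqrt (Num.sqrt (1 - k (2 * n)%N ^+ 2)).
have t0 : 0 <= t by apply: sqrtr_ge0.
have t4 : 1 - k (2 * n)%N ^+ 2 = t ^+ 4.
  by rewrite (exprM t 2 2) !sqr_sqrtr ?sqrtr_ge0 // ltW.
have [k1 k2] := borwein2_two_steps _ _ t0 t4.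
have yt : y n.+1 = (1 - t) / (1 + t).
  by rewrite borwein4_yS y4 powR_quarter // ltW.
split; first by rewrite yt k2.
(* What remains is a rational identity in [t]; the coefficients of [e (2 * n)] agree because [(1 +
   k1) * (1 + k2) = 4 / (1 + t) ^+ 2 = (1 + y n.+1) ^+ 2], with [k1], [k2] standing for the two
   moduli. *)
rewrite borwein4_zS !borwein2_eS ze k1 k2 yt.
have -> : 4 ^+ n.+1 = 4 * 2 ^+ (2 * n)%N :> R.
  by rewrite exprS exprM (_ : 2 ^+ 2 = 4) //; ring.
rewrite (exprS 2 (2 * n).+2) !(exprS 2 (2 * n).+1) !(exprS 2 (2 * n)).
by have t2 := sqr_ge0 t; field; rewrite !lt0r_neq0 //; lra.
Qed.

Lemma borwein2_pi_brent_salamin n : borwein2_pi R n = brent_salamin_p R n.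
Proof.
have [a0 b0] := brent_salamin_gt0 n.
rewrite /borwein2_pi /brent_salamin_p -borwein2_eM invfM mulrCA divff ?mulr1 ?mul1r //.
by rewrite expf_neq0 // lt0r_neq0 // addr_gt0.
Qed.

End BrentSalaminBorwein.

Theorem theorem1 (R : realType) (N : nat) :
  borwein2_pi R N = brent_salamin_p R N /\
  (borwein4_pi R N = borwein2_pi R (2 * N)%N /\ borwein2_pi R (2 * N)%N = brent_salamin_p R (2 * N)%N).
Proof.
split; first exact: borwein2_pi_brent_salamin.
split; last exact: borwein2_pi_brent_salamin.
by rewrite /borwein4_pi /borwein2_pi (borwein4_yzE R N).2.
Qed.
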